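(* Let $G$ be a locally finite, connected graph with at most countably many ends. Then for every finite set of vertices $A'$ of $G$ there is a finite set of vertices $A \supseteq A'$ such that every connected component of $G-A$ is boundary-linked.
   Context: A ray is a one-way infinite path. Two rays of $G$ are equivalent if there are infinitely many pairwise vertex-disjoint paths between them in $G$; an end of $G$ is an equivalence class of rays. For a set of vertices $B$, its boundary is the set of edges of $G$ with exactly one endvertex in $B$. A set of vertices $B$ (here, the vertex set of a component) is called boundary-linked if the subgraph consisting of the induced subgraph $G[B]$ together with the boundary edges of $B$ (and their endvertices) contains a collection of pairwise edge-disjoint, pairwise equivalent (in $G$) rays $R_1, R_2, \ldots$ such that each edge of the boundary of $B$ is the first edge of one of the rays $R_i$. *)

(* Defs.v *)
From Stdlib Require Import List.
Import ListNotations.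
Set Implicit Arguments.

Section Graphs.
Variable V : Type.
Variable adj : V -> V -> Prop.

Definition simple_graph : Prop :=
  (forall u v, adj u v -> adj v u) /\ (forall v, ~ adj v v).

Definition locally_finite : Prop :=
  forall v, exists l : list V, forall w, adj v w -> In w l.

Definition finite_set (A : V -> Prop) : Prop :=
  exists l : list V, forall x, A x -> In x l.

Inductive walk_in (P : V -> Prop) : V -> V -> Prop :=
| walk_refl : forall u, P u -> walk_in P u u
| walk_step : forall u w v, P u -> adj u w -> walk_in P w v -> walk_in P u v.

Definition connected : Prop :=
  forall u v, walk_in (fun _ => True) u v.

Fixpoint chain (x : V) (l : list V) : Prop :=
  match l with
  | [] => True
  | y :: l' => adj x y /\ chain y l'
  end.

Definition is_path (x : V) (l : list V) : Prop :=
  NoDup (x :: l) /\ chain x l.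

Definition is_ray (r : nat -> V) : Prop :=
  (forall m n, r m = r n -> m = n) /\ (forall n, adj (r n) (r (S n))).

Definition equiv_rays (r1 r2 : nat -> V) : Prop :=
  exists P : nat -> V * list V,
    (forall i, is_path (fst (P i)) (snd (P i)) /\
               (exists m, r1 m = fst (P i)) /\
               (exists n, r2 n = last (snd (P i)) (fst (P i)))) /\
    (forall i j, i <> j -> forall v,
        In v (fst (P i) :: snd (P i)) -> ~ In v (fst (P j) :: snd (P j))).

(* G has at most countably many ends: there is a sequence of rays meeting
   every end (equivalence class of rays) *)
Definition countably_many_ends : Prop :=
  exists f : nat -> (nat -> V),
    forall r, is_ray r -> exists n, is_ray (f n) /\ equiv_rays r (f n).

Definition component_of_minus (A C : V -> Prop) : Prop :=
  exists v, ~ A v /\ forall x, C x <-> walk_in (fun y => ~ A y) v x.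

Definition same_edge (a b c d : V) : Prop :=
  (a = c /\ b = d) \/ (a = d /\ b = c).

Definition boundary_edge (B : V -> Prop) (u w : V) : Prop :=
  adj u w /\ ((B u /\ ~ B w) \/ (~ B u /\ B w)).

(* a ray of G contained in G[B] together with the boundary edges of B:
   every edge of the ray has at least one endvertex in B *)
Definition ray_in_boundary_graph (B : V -> Prop) (r : nat -> V) : Prop :=
  is_ray r /\ forall n, B (r n) \/ B (r (S n)).

Definition edge_disjoint_rays (r1 r2 : nat -> V) : Prop :=
  forall m n, ~ same_edge (r1 m) (r1 (S m)) (r2 n) (r2 (S n)).

Definition boundary_linked (B : V -> Prop) : Prop :=
  exists (S : nat -> Prop) (R : nat -> nat -> V),
    (forall i, S i -> ray_in_boundary_graph B (R i)) /\
    (forall i j, S i -> S j -> i <> j -> edge_disjoint_rays (R i) (R j)) /\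
    (forall i j, S i -> S j -> equiv_rays (R i) (R j)) /\
    (forall u w, boundary_edge B u w ->
       exists i, S i /\ same_edge (R i 0) (R i 1) u w).

End Graphs.

(* Main.v *)
Require Import Defs.
From Stdlib Require Import List.
From Stdlib Require Import Arith Lia ZArith Permutation.
From Stdlib Require Import Classical ClassicalEpsilon FunctionalExtensionality PropExtensionality.
Import ListNotations.

(** Call a set of vertices resolvable if, for every finite [A], enlarging [A]
    to some finite set leaves only boundary-linked components in it.  Around the
    end of a ray [g], away from a given finite set, choose a connected region [C]
    with as few boundary edges as possible.  Inside [C] there is a nested
    sequence of such regions shrinking to the end; by minimality and Menger's
    theorem the boundary edges of each are linked, edge-disjointly, to those of
    the next, and the concatenated linkages show that [C] is boundary-linked.
    So a region that is not resolvable contains, after removing [C] and its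
    neighbours, a component that is not resolvable and that misses the end of
    [g].  Treating the countably many ends in turn yields a decreasing sequence
    of connected regions with finite boundary; a ray with a tail in each of them
    would be equivalent to none of the listed rays. *)

(** * Choice and finite sets *)

Notation em := excluded_middle_informative.

Lemma dependent_choice (St : Type) (I : St -> Prop) (Q : nat -> St -> St -> Prop) (s0 : St) :
  I s0 -> (forall n s, I s -> exists s', I s' /\ Q n s s') ->
  exists f, f 0 = s0 /\ forall n, I (f n) /\ Q n (f n) (f (S n)).
Proof.
  intros H0 H.
  assert (H' : forall n s, exists s', I s -> I s' /\ Q n s s').
  { intros n s. destruct (em (I s)) as [i|i].
    - destruct (H n s i) as [s' Hs]. exists s'; auto.
    - exists s; tauto. }
  set (g := fun n s => proj1_sig (constructive_indefinite_description _ (H' n s))).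
  assert (Hg : forall n s, I s -> I (g n s) /\ Q n s (g n s)).
  { intros n s. unfold g. exact (proj2_sig (constructive_indefinite_description _ (H' n s))). }
  exists (fix f n := match n with 0 => s0 | S m => g m (f m) end).
  split; [reflexivity|].
  intros n.
  assert (Hi : I ((fix f n := match n with 0 => s0 | S m => g m (f m) end) n)).
  { induction n; [exact H0|]. apply Hg, IHn. }
  split; [exact Hi|]. apply Hg, Hi.
Qed.

Lemma functional_choice (X Y : Type) (Q : X -> Y -> Prop) :
  (forall x, exists y, Q x y) -> exists f, forall x, Q x (f x).
Proof.
  intros H.
  exists (fun x => proj1_sig (constructive_indefinite_description _ (H x))).
  intros x. exact (proj2_sig (constructive_indefinite_description _ (H x))).
Qed.

Lemma exact_list (X : Type) (Q : X -> Prop) (L : list X) :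
  (forall x, Q x -> In x L) -> exists l, NoDup l /\ forall x, In x l <-> Q x.
Proof.
  intros H.
  assert (dec : forall x y : X, {x = y} + {x <> y}) by (intros; apply em).
  exists (nodup dec (filter (fun x => if em (Q x) then true else false) L)).
  split; [apply NoDup_nodup|].
  intros x. rewrite nodup_In, filter_In.
  specialize (H x). destruct (em (Q x)); split; try tauto.
  intros [_ e]. discriminate e.
Qed.

Lemma least_nat (Q : nat -> Prop) (n : nat) :
  Q n -> exists m, Q m /\ forall k, Q k -> m <= k.
Proof.
  induction n as [n IH] using lt_wf_ind. intros Hn.
  destruct (em (exists k, k < n /\ Q k)) as [(k & Hk & Qk)|Hno].
  - exact (IH k Hk Qk).
  - exists n. split; [assumption|]. intros k Qk.
    destruct (le_lt_dec n k); [assumption|]. exfalso. eauto.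
Qed.

Lemma pred_ext (X : Type) (P Q : X -> Prop) : (forall x, P x <-> Q x) -> P = Q.
Proof.
  intros H. apply functional_extensionality. intros x.
  apply propositional_extensionality, H.
Qed.

(** * Walks *)

Fixpoint arcs {V : Type} (x : V) (l : list V) : list (V * V) :=
  match l with
  | [] => []
  | y :: l' => (x, y) :: arcs y l'
  end.

Section Walks.
Set Implicit Arguments.
Context {V : Type}.
Implicit Types (E : V -> V -> Prop) (P Q : V -> Prop) (l : list V).

Lemma walk_ends E P u v : walk_in E P u v -> P u /\ P v.
Proof. induction 1; tauto. Qed.

Lemma walk_app E P u v w : walk_in E P u v -> walk_in E P v w -> walk_in E P u w.
Proof.
  induction 1; [auto|]. intros. eapply walk_step; eauto.
Qed.

Lemma walk_sym E P u v :
  (forall a b, E a b -> E b a) -> walk_in E P u v -> walk_in E P v u.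
Proof.
  intros sym. induction 1.
  - constructor; assumption.
  - apply walk_app with w; [assumption|].
    apply walk_step with u; auto.
    + apply (walk_ends H1).
    + constructor; assumption.
Qed.

Lemma walk_snoc E P u v w : walk_in E P u v -> E v w -> P w -> walk_in E P u w.
Proof.
  intros H e p. apply walk_app with v; [assumption|].
  apply walk_step with w; auto.
  - apply (walk_ends H).
  - constructor; assumption.
Qed.

Lemma walk_invariant E P Q u v :
  walk_in E P u v -> Q u ->
  (forall a b, Q a -> P a -> E a b -> P b -> Q b) ->
  walk_in E (fun x => P x /\ Q x) u v.
Proof.
  intros H. induction H as [u Hu|u w v Hu e H IH]; intros q inv.
  - constructor; tauto.
  - apply walk_step with w; auto. apply IH; [|assumption].
    apply inv with u; auto. apply (walk_ends H).
Qed.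

Lemma walk_mono E P Q u v :
  walk_in E P u v -> (forall x, P x -> Q x) -> walk_in E Q u v.
Proof.
  intros H m. induction H; [constructor; auto|].
  eapply walk_step; eauto.
Qed.

(** Cut the walk at its first vertex outside [Q]. *)
Lemma walk_exit E P Q u v :
  walk_in E P u v -> Q u -> ~ Q v ->
  exists a b, walk_in E (fun x => P x /\ Q x) u a /\ E a b /\ P b /\ ~ Q b.
Proof.
  intros H. induction H as [u Hu|u w v Hu e H IH]; intros q nq; [contradiction|].
  destruct (em (Q w)) as [qw|nqw].
  - destruct (IH qw nq) as (a & b & W & R). exists a, b. split; [|exact R].
    apply walk_step with w; auto.
  - exists u, w. repeat split; auto.
    + constructor; auto.
    + apply (walk_ends H).
Qed.

Lemma last_cons (l : list V) x d : last (x :: l) d = last l x.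
Proof.
  revert x d. induction l as [|y l IH]; intros x d; [reflexivity|].
  change (last (y :: l) d = last (y :: l) x). rewrite !IH. reflexivity.
Qed.

Lemma last_app_cons (l1 l2 : list V) x d : last (l1 ++ x :: l2) d = last l2 x.
Proof.
  revert d. induction l1 as [|y l1 IH]; intros d; cbn [app]; rewrite last_cons; auto.
Qed.

Lemma last_In (l : list V) x : In (last l x) (x :: l).
Proof.
  revert x. induction l as [|y l IH]; intros x; [now left|].
  rewrite last_cons. right. apply IH.
Qed.

Lemma chain_app E x l1 y l2 :
  chain E x (l1 ++ y :: l2) <-> chain E x l1 /\ E (last l1 x) y /\ chain E y l2.
Proof.
  revert x. induction l1 as [|z l1 IH]; intros x; cbn [app chain].
  - cbn; tauto.
  - rewrite last_cons, IH. tauto.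
Qed.

Lemma walk_path E P u v :
  walk_in E P u v ->
  exists l, NoDup (u :: l) /\ chain E u l /\ Forall P (u :: l) /\ last l u = v.
Proof.
  induction 1 as [u Hu|u w v Hu e H (l & N & C & F & L)].
  - exists []. repeat split; auto. repeat constructor; cbn; tauto.
  - destruct (em (In u (w :: l))) as [i|i].
    + destruct (in_split _ _ i) as (l1 & l2 & eq). exists l2.
      assert (C' : chain E u (w :: l)) by (cbn; auto).
      rewrite eq in C'. apply chain_app in C'.
      rewrite eq in N, F. apply NoDup_app_remove_l in N.
      apply Forall_app in F. repeat split; try tauto.
      rewrite <- L, <- (last_cons l w u), eq. symmetry. apply last_app_cons.
    + exists (w :: l). repeat split; auto.
      * constructor; assumption.
      * rewrite last_cons; exact L.
Qed.

Lemma path_walk E P l : forall u,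
  chain E u l -> Forall P (u :: l) -> walk_in E P u (last l u).
Proof.
  induction l as [|w l IH]; intros u C F.
  - constructor. inversion F; assumption.
  - rewrite last_cons. inversion F; subst. destruct C.
    apply walk_step with w; auto.
Qed.

Lemma chain_arcs E l : forall x,
  chain E x l <-> forall a b, In (a, b) (arcs x l) -> E a b.
Proof.
  induction l as [|y l IH]; intros x; cbn; [tauto|].
  rewrite IH. split.
  - intros [e H] a b [i|i]; [congruence|auto].
  - intros H; auto.
Qed.

Lemma arcs_in l : forall x a b, In (a, b) (arcs x l) -> In a (x :: l) /\ In b l.
Proof.
  induction l as [|y l IH]; intros x a b; cbn; [tauto|].
  intros [i|i].
  - injection i; intros; subst; auto.
  - apply IH in i. cbn in i. tauto.
Qed.

Lemma arcs_app x l1 y l2 :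
  arcs x (l1 ++ y :: l2) = arcs x l1 ++ (last l1 x, y) :: arcs y l2.
Proof.
  revert x. induction l1 as [|z l1 IH]; intros x; [reflexivity|].
  rewrite last_cons. cbn. now rewrite IH.
Qed.

Lemma arcs_snoc_fst l y x a b : In (a, b) (arcs x (l ++ [y])) -> In a (x :: l).
Proof.
  rewrite arcs_app, in_app_iff. intros [i|[i|[]]].
  - apply arcs_in in i. apply i.
  - injection i; intros; subst. apply last_In.
Qed.

Lemma arcs_NoDup l : forall x, NoDup (x :: l) -> NoDup (arcs x l).
Proof.
  induction l as [|y l IH]; intros x N; cbn; [constructor|].
  inversion N; subst. constructor; [|auto].
  intros i. apply arcs_in in i. tauto.
Qed.

(* The infinite concatenation of the segments [h n :: t n]; the disjoint layers
   [C n \ C (n+1)] make it injective. *)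
Lemma concat_segments E (C : nat -> V -> Prop) (h : nat -> V) (t : nat -> list V) :
  (forall n x, C (S n) x -> C n x) ->
  (forall n, NoDup (h n :: t n) /\ Forall (fun x => C n x /\ ~ C (S n) x) (h n :: t n)
             /\ chain E (h n) (t n ++ [h (S n)])) ->
  exists r, is_ray E r /\ r 0 = h 0 /\
    (forall n, exists N, forall m, N <= m -> C n (r m)) /\
    (forall m, exists n, In (r m, r (S m)) (arcs (h n) (t n ++ [h (S n)]))).
Proof.
  intros dec seg.
  assert (mono : forall m n, n <= m -> forall x, C m x -> C n x).
  { intros m n le. induction le; auto. }
  set (pre := fix pre n := match n with 0 => [] | S m => pre m ++ h m :: t m end).
  assert (len : forall n, n <= length (pre n)).
  { induction n; cbn; [lia|]. rewrite length_app; cbn; lia. }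
  assert (pre_out : forall n x, In x (pre n) -> ~ C n x).
  { induction n; cbn; [tauto|]. intros x i.
    apply in_app_iff in i. destruct i as [i|i].
    - intros c. apply (IHn x i). auto.
    - destruct (seg n) as (_ & F & _). rewrite Forall_forall in F. apply F, i. }
  assert (pre_nodup : forall n, NoDup (pre n)).
  { induction n; cbn; [constructor|].
    destruct (seg n) as (N & F & _). rewrite Forall_forall in F.
    apply NoDup_app; auto. intros a i j. apply (pre_out n a i), F, j. }
  assert (pre_ext : forall m n, n <= m -> exists l, pre m = pre n ++ l).
  { intros m n le. induction le as [|m le [l IH]].
    - exists []. now rewrite app_nil_r.
    - exists (l ++ h m :: t m). cbn. now rewrite IH, app_assoc. }
  assert (stable : forall m n i d, n <= m -> i < length (pre n) -> nth i (pre m) d = nth i (pre n) d).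
  { intros m n i d le lt. destruct (pre_ext m n le) as [l ->]. now apply app_nth1. }
  (* [pre (S m)] has more than [m] entries because no segment is empty, so the default [h 0] is
     never read. *)
  set (r := fun m => nth m (pre (S m)) (h 0)).
  assert (r_eq : forall n m, m < length (pre n) -> r m = nth m (pre n) (h 0)).
  { intros n m lt. unfold r. destruct (le_lt_dec n (S m)).
    - now apply stable.
    - symmetry. apply stable; [lia|]. specialize (len (S m)). lia. }
  assert (r_layer : forall n i, i <= length (t n) ->
            r (length (pre n) + i) = nth i (h n :: t n) (h 0)).
  { intros n i le. rewrite (r_eq (S n)).
    - cbn [pre]. rewrite app_nth2 by lia. f_equal. lia.
    - cbn [pre]. rewrite length_app. cbn. lia. }
  assert (locate : forall m, exists n i, i <= length (t n) /\ m = length (pre n) + i).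
  { intros m. assert (Hn : forall n, m < length (pre n) ->
        exists n i, i <= length (t n) /\ m = length (pre n) + i).
    { induction n; cbn; [lia|]. intros lt. rewrite length_app in lt. cbn in lt.
      destruct (le_lt_dec (length (pre n)) m); [|auto].
      exists n, (m - length (pre n)). lia. }
    apply (Hn (S m)). specialize (len (S m)). lia. }
  assert (step : forall m, exists n, In (r m, r (S m)) (arcs (h n) (t n ++ [h (S n)]))).
  { intros m. destruct (locate m) as (n & i & le & ->). exists n.
    rewrite (r_layer n i le).
    (* After the last vertex of a segment comes the head of the next one, which is why the arcs are
       taken along [t n ++ [h (S n)]]. *)
    assert (next : r (S (length (pre n) + i)) = nth i (t n ++ [h (S n)]) (h 0)).
    { destruct (le_lt_eq_dec _ _ le) as [lt|eq].
      - replace (S (length (pre n) + i)) with (length (pre n) + S i) by lia.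
        rewrite r_layer by lia. cbn [nth]. now rewrite app_nth1.
      - replace (S (length (pre n) + i)) with (length (pre (S n)) + 0)
          by (cbn [pre]; rewrite length_app; cbn; lia).
        rewrite r_layer by lia. cbn [nth]. rewrite app_nth2 by lia.
        now replace (i - length (t n)) with 0 by lia. }
    rewrite next.
    assert (gen : forall l x y j, j <= length l ->
        In (nth j (x :: l) (h 0), nth j (l ++ [y]) (h 0)) (arcs x (l ++ [y]))).
    { induction l as [|z l IH]; intros x y j lj.
      - cbn in lj. replace j with 0 by lia. cbn. auto.
      - destruct j; [cbn; auto|]. right. apply (IH z y j). cbn in lj. lia. }
    now apply gen. }
  exists r. split; [|split; [|split]].
  - split.
    + intros m n eq.
      set (k := S (Nat.max m n)).
      assert (m < length (pre k) /\ n < length (pre k)) as [lm ln]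
        by (specialize (len k); lia).
      rewrite (r_eq k m lm), (r_eq k n ln) in eq.
      apply (proj1 (NoDup_nth (pre k) (h 0)) (pre_nodup k)); assumption.
    + intros m. destruct (step m) as [n i].
      destruct (seg n) as (_ & _ & c). rewrite chain_arcs in c. auto.
  - reflexivity.
  - intros n. exists (length (pre n)). intros m le.
    destruct (locate m) as (n' & i & li & ->).
    rewrite r_layer by assumption.
    assert (nn : n <= n').
    { destruct (le_lt_dec n n') as [?|gt]; [assumption|exfalso].
      destruct (pre_ext n (S n') ltac:(lia)) as [l el].
      rewrite el in le. cbn [pre] in le. rewrite !length_app in le. cbn in le. lia. }
    apply (mono n' n nn).
    destruct (seg n') as (_ & F & _). rewrite Forall_forall in F.
    apply F. apply nth_In. cbn. lia.
  - exact step.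
Qed.

End Walks.

(** * Unit flows and the edge version of Menger's theorem *)

Lemma sublist_perm (X : Type) (l F : list X) :
  NoDup l -> incl l F -> exists F', Permutation F (l ++ F').
Proof.
  revert F. induction l as [|a l IH]; intros F N inc; [exists F; reflexivity|].
  inversion N; subst.
  destruct (in_split a F) as (F1 & F2 & ->); [apply inc; now left|].
  destruct (IH (F1 ++ F2)) as [F' p]; [assumption| |].
  - intros x i. assert (j : In x (F1 ++ a :: F2)) by (apply inc; now right).
    rewrite in_app_iff in *. destruct j as [j|[->|j]]; auto. contradiction.
  - exists F'. rewrite <- Permutation_middle, p. reflexivity.
Qed.

Section Flows.
Set Implicit Arguments.
Context {V : Type}.
Implicit Types (F : list (V * V)) (S T : V -> Prop).

Definition indicator S v : Z := if em (S v) then 1%Z else 0%Z.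

(* The net number of arcs of [F] that leave [S]. *)
Definition net F S : Z :=
  fold_right (fun a z => (indicator S (fst a) - indicator S (snd a) + z)%Z) 0%Z F.

Lemma net_app F F' S : net (F ++ F') S = (net F S + net F' S)%Z.
Proof. induction F as [|a F IH]; cbn; [reflexivity|]. fold (net (F ++ F') S). rewrite IH. unfold net. lia. Qed.

Lemma net_cons a F S : net (a :: F) S = (indicator S (fst a) - indicator S (snd a) + net F S)%Z.
Proof. reflexivity. Qed.

Lemma net_perm F F' S : Permutation F F' -> net F S = net F' S.
Proof. induction 1; rewrite ?net_cons in *; lia. Qed.

Lemma net_arcs l S : forall x, net (arcs x l) S = (indicator S x - indicator S (last l x))%Z.
Proof.
  induction l as [|y l IH]; intros x; [cbn; lia|].
  rewrite last_cons. cbn [arcs]. rewrite net_cons, IH. cbn. lia.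
Qed.

Lemma net_ext F S T :
  (forall a b, In (a, b) F -> (S a <-> T a) /\ (S b <-> T b)) -> net F S = net F T.
Proof.
  induction F as [|[a b] F IH]; intros H; [reflexivity|].
  rewrite !net_cons, IH by (intros; apply H; now right).
  destruct (H a b (or_introl eq_refl)). unfold indicator; cbn.
  destruct (em (S a)), (em (S b)), (em (T a)), (em (T b)); try tauto; lia.
Qed.

Lemma net_union F S T U :
  (forall v, U v <-> S v \/ T v) -> (forall v, S v -> T v -> False) ->
  net F U = (net F S + net F T)%Z.
Proof.
  intros HU HD. induction F as [|[a b] F IH]; [reflexivity|].
  rewrite !net_cons, IH. unfold indicator; cbn.
  pose proof (HU a); pose proof (HU b); pose proof (HD a); pose proof (HD b).
  destruct (em (S a)), (em (S b)), (em (T a)), (em (T b)), (em (U a)), (em (U b));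
    try tauto; lia.
Qed.

(** Sum the conservation law over the vertices of [S]; only the finitely many endvertices of arcs of
    [F] matter. *)
Lemma net_conserved F S : (forall v, S v -> net F (eq v) = 0%Z) -> net F S = 0%Z.
Proof.
  intros H.
  assert (HL : forall L, net F (fun x => S x /\ In x L) = 0%Z).
  { induction L as [|a L IH].
    - rewrite (net_ext F _ (fun _ => False)) by (cbn; tauto).
      clear. induction F as [|b F IH]; [reflexivity|].
      rewrite net_cons, IH. unfold indicator.
      destruct (em False); [contradiction|reflexivity].
    - destruct (em (S a /\ ~ In a L)) as [[s n]|n].
      + rewrite (net_union F (fun x => S x /\ In x L) (eq a)).
        * rewrite IH, H by assumption. reflexivity.
        * intros v; cbn. split; intuition (subst; tauto).
        * intros v [_ i] e. subst. contradiction.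
      + rewrite <- IH. apply net_ext. intros x y _; cbn.
        split; split; intuition (subst; tauto). }
  rewrite <- (HL (map fst F ++ map snd F)). apply net_ext.
  intros a b i. rewrite !in_app_iff.
  pose proof (in_map fst _ _ i). pose proof (in_map snd _ _ i). cbn in *. tauto.
Qed.

Definition leaving F S : list (V * V) :=
  filter (fun a => if em (S (fst a) /\ ~ S (snd a)) then true else false) F.

Lemma in_leaving F S a b : In (a, b) (leaving F S) <-> In (a, b) F /\ S a /\ ~ S b.
Proof.
  unfold leaving. rewrite filter_In. cbn. destruct (em (S a /\ ~ S b)); split; try tauto.
  intros [_ e]; discriminate e.
Qed.

(** Arcs with both ends on one side cancel, and leaving the complement means entering [S]. *)
Lemma net_leaving F S :
  net F S = (Z.of_nat (length (leaving F S))
             - Z.of_nat (length (leaving F (fun x => ~ S x))))%Z.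
Proof.
  induction F as [|[a b] F IH]; [reflexivity|].
  rewrite net_cons, IH. unfold leaving, indicator; cbn.
  destruct (em (S a /\ ~ S b)), (em (~ S a /\ ~ ~ S b)), (em (S a)), (em (S b));
    try tauto; cbn [length]; lia.
Qed.

Variable E : V -> V -> Prop.

(** The last clause forbids using both orientations of an edge, so an undirected edge carries at
    most one unit. *)
Definition unit_flow F :=
  NoDup F /\ (forall a b, In (a, b) F -> E a b) /\
  (forall a b, In (a, b) F -> ~ In (b, a) F).

(** For a unit flow and symmetric [E] this is the usual residual graph: the reversal of an arc of
    [F] is never in [F], hence residual. *)
Definition residual F a b := E a b /\ ~ In (a, b) F.

Hypothesis E_sym : forall a b, E a b -> E b a.

(** Cancel the opposite arc if it carries flow, otherwise add the arc. The last clause records that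
    only arcs at [a] change. *)
Lemma flow_push F a b :
  unit_flow F -> residual F a b -> a <> b ->
  exists F', unit_flow F' /\ (forall S, net F' S = (net F S + indicator S a - indicator S b)%Z) /\
    forall x y, x <> a -> y <> a -> (In (x, y) F' <-> In (x, y) F).
Proof.
  intros (N & A & O) [e n] ne.
  destruct (em (In (b, a) F)) as [i|i].
  - destruct (in_split _ _ i) as (F1 & F2 & ->). exists (F1 ++ F2).
    assert (sub : forall c, In c (F1 ++ F2) -> In c (F1 ++ (b, a) :: F2)).
    { intros c. rewrite !in_app_iff. cbn. tauto. }
    split; [|split].
    + split; [eapply NoDup_remove_1; eauto|]. split; [auto|].
      intros x y j k. apply (O x y); auto.
    + intros S. rewrite !net_app, net_cons. cbn. lia.
    + intros x y nx ny. rewrite !in_app_iff. cbn.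
      split; [tauto|]. intros [j|[j|j]]; auto. congruence.
  - exists ((a, b) :: F). split; [|split].
    + split; [now constructor|]. split.
      * intros x y [j|j]; [congruence|auto].
      * intros x y [j|j] [k|k].
        -- congruence.
        -- congruence.
        -- congruence.
        -- exact (O x y j k).
    + intros S. rewrite net_cons. cbn. lia.
    + intros x y nx ny. cbn. split; [|tauto]. intros [j|j]; congruence.
Qed.

(** Push along one arc at a time. The path is simple, so its later arcs avoid [x] and remain
    residual after the first push. *)
Lemma flow_augment l : forall F x,
  unit_flow F -> NoDup (x :: l) -> chain (residual F) x l ->
  exists F', unit_flow F' /\
    forall S, net F' S = (net F S + indicator S x - indicator S (last l x))%Z.
Proof.
  induction l as [|y l IH]; intros F x U N C.
  - exists F. split; [assumption|]. intros; cbn; lia.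
  - destruct C as [r C]. inversion N as [|? ? nx N']; subst.
    destruct (@flow_push F x y) as (F1 & U1 & n1 & same); auto.
    { intros ->. apply nx. now left. }
    destruct (IH F1 y) as (F' & U' & n'); auto.
    + apply chain_arcs. intros a b i.
      assert (r' : residual F a b) by (revert a b i; apply chain_arcs; assumption).
      destruct r' as [e ni]. split; [assumption|].
      apply arcs_in in i. destruct i as [ia ib].
      rewrite same; auto; intros ->; apply nx; [assumption|now right].
    + exists F'. split; [assumption|]. intros S.
      rewrite last_cons, n', n1. lia.
Qed.

(** Each boundary edge is listed once, oriented into [C]; the existence of such a list says that the
    boundary is finite. *)
Definition boundary_list (C : V -> Prop) (l : list (V * V)) : Prop :=
  NoDup l /\ forall u w, In (u, w) l <-> E u w /\ ~ C u /\ C w.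

(** * Menger's theorem between the boundary of a region and a smaller region inside it *)

Section Link.
Variables (C C' : V -> Prop) (B : list (V * V)).
Hypothesis B_boundary : boundary_list C B.
Hypothesis sub : forall v, C' v -> C v.

(** Vertices outside [C] act as sources and vertices of [C'] as sinks. *)
Definition conserves F := forall v, C v -> ~ C' v -> net F (eq v) = 0%Z.

Hypothesis cut_bound : forall Y l,
  (forall v, C' v -> Y v) -> (forall v, Y v -> C v) ->
  boundary_list Y l -> length B <= length l.

(* If no augmenting path exists, the vertices reachable in the residual graph
   give a cut that [F] saturates, so its size is the value of [F]. *)
Lemma flow_increase F j :
  unit_flow F -> conserves F -> net F (fun v => ~ C v) = Z.of_nat j -> j < length B ->
  exists F', unit_flow F' /\ conserves F' /\ net F' (fun v => ~ C v) = Z.of_nat (Datatypes.S j).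
Proof.
  intros U K val lt.
  set (S := fun y => exists p, ~ C p /\ walk_in (residual F) (fun _ => True) p y).
  destruct (em (exists y, S y /\ C' y)) as [(y & (p & np & W) & Cy)|no].
  - destruct (walk_path W) as (l & N & ch & _ & la).
    destruct (flow_augment U N ch) as (F' & U' & n').
    exists F'. split; [assumption|]. split.
    + intros v cv ncv. rewrite n', la, K by assumption. unfold indicator.
      destruct (em (v = p)); [subst; contradiction|].
      destruct (em (v = y)); [subst; contradiction|]. reflexivity.
    + rewrite n', la, val. unfold indicator.
      destruct (em (~ C p)); [|contradiction].
      destruct (em (~ C y)); [exfalso; auto|]. lia.
  - exfalso.
    assert (S_src : forall v, ~ C v -> S v).
    { intros v nv. exists v. split; [assumption|]. now constructor. }
    assert (S_step : forall a b, S a -> E a b -> ~ In (a, b) F -> S b).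
    { intros a b (p & np & W) e ni. exists p. split; [assumption|].
      apply walk_snoc with a; auto. now split. }
    destruct U as (N & A & O).
    (* An arc of the flow entering [S] would have a residual reversal leading out of [S]. *)
    assert (none : leaving F (fun x => ~ S x) = []).
    { destruct (leaving F (fun x => ~ S x)) as [|[a b] l] eqn:eq; [reflexivity|exfalso].
      assert (i : In (a, b) (leaving F (fun x => ~ S x))) by (rewrite eq; now left).
      apply in_leaving in i. destruct i as (i & na & nb). apply nb. intros sb.
      apply na. apply (S_step b a); auto. }
    (* The complement of [S] lies between [C'] and [C], and its boundary consists of flow arcs: an
       edge leaving [S] but missing from [F] would extend [S]. *)
    assert (big : length B <= length (leaving F S)).
    { apply (cut_bound (Y := fun x => ~ S x)).
      - intros v cv sv. apply no. eauto.
      - intros v nsv. apply NNPP. auto.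
      - split; [now apply NoDup_filter|]. intros u w. rewrite in_leaving. split.
        + intros (i & su & nw). repeat split; auto.
        + intros (e & nsu & nw). apply NNPP in nsu. repeat split; auto.
          apply NNPP. intros ni. apply nw. eauto. }
    pose proof (net_leaving F S) as nS. rewrite none in nS. cbn in nS.
    (* [S] consists of the outside of [C] and of vertices where the flow is conserved, so the net
       flow out of [S] is the value [j]. *)
    assert (eqS : net F S = net F (fun v => ~ C v)).
    { rewrite (net_union F (fun v => ~ C v) (fun v => C v /\ S v)).
      - rewrite (net_conserved F (fun v => C v /\ S v)); [lia|].
        intros v [cv sv]. apply K; [assumption|]. intros c'. apply no. eauto.
      - intros v. destruct (em (C v)); split; intuition.
      - cbn. tauto. }
    lia.
Qed.

(** Augment until the value is [length B]. At most [length B] arcs can enter [C], so this value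
    forces every boundary edge to be used inwards and no arc to leave [C]. *)
Lemma max_flow :
  exists F, unit_flow F /\ conserves F /\ (forall e, In e B -> In e F) /\
    forall a b, In (a, b) F -> C a -> C b.
Proof.
  assert (H : forall j, j <= length B -> exists F, unit_flow F /\ conserves F /\
                net F (fun v => ~ C v) = Z.of_nat j).
  { induction j; intros le.
    - exists []. split; [|split].
      + split; [constructor|]. cbn; tauto.
      + intros v _ _. reflexivity.
      + reflexivity.
    - destruct IHj as (F & U & K & val); [lia|]. now apply flow_increase with F. }
  destruct (H (length B) (le_n _)) as (F & U & K & val).
  exists F. split; [assumption|]. split; [assumption|].
  rewrite net_leaving in val.
  assert (incl (leaving F (fun v => ~ C v)) B) as inc.
  { intros [a b] i. apply in_leaving in i. destruct i as (i & na & nb).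
    apply (proj2 B_boundary). repeat split; auto.
    - now apply U.
    - now apply NNPP. }
  assert (N : NoDup (leaving F (fun v => ~ C v))) by (apply NoDup_filter, U).
  pose proof (NoDup_incl_length N inc).
  split.
  - intros e i. assert (i' : In e (leaving F (fun v => ~ C v))).
    { revert e i. apply (NoDup_length_incl N); [lia|assumption]. }
    unfold leaving in i'. apply filter_In in i'. apply i'.
  - intros a b i ca.
    destruct (leaving F (fun x => ~ ~ C x)) as [|c l] eqn:eq; [|cbn in val; lia].
    apply NNPP. intros nb.
    assert (i' : In (a, b) (leaving F (fun x => ~ ~ C x))) by (apply in_leaving; tauto).
    rewrite eq in i'. destruct i'.
Qed.

(** Starting at the head of the entering arc, follow arcs of the flow until [C'] is reached, then
    remove the path found. *)
Lemma flow_peel F u w :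
  unit_flow F -> conserves F -> (forall a b, In (a, b) F -> C a -> C b) ->
  In (u, w) F -> ~ C u -> C w -> ~ C' w ->
  exists l y F', NoDup (w :: l) /\ Forall (fun x => C x /\ ~ C' x) (w :: l) /\ C' y /\
    Permutation F (arcs u (w :: l ++ [y]) ++ F').
Proof.
  intros U K inw i nu cw ncw.
  set (Z := walk_in (fun a b => In (a, b) F) (fun x => C x /\ ~ C' x) w).
  assert (HZ : forall z, Z z -> C z /\ ~ C' z) by (intros z Hz; apply (walk_ends Hz)).
  (* Otherwise no arc of the flow leaves [Z], although [(u, w)] enters it, contradicting
     conservation on [Z]. *)
  assert (ex : exists x y, Z x /\ C' y /\ In (x, y) F).
  { apply NNPP. intros no.
    assert (closed : forall a b, Z a -> In (a, b) F -> Z b).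
    { intros a b za j. apply walk_snoc with a; auto. split; [apply (inw a b j), HZ, za|].
      intros cb. apply no. eauto. }
    assert (zw : Z w) by (constructor; auto).
    assert (nZ : net F Z = 0%Z).
    { apply net_conserved. intros v zv. apply HZ in zv. now apply K. }
    rewrite net_leaving in nZ.
    destruct (leaving F Z) as [|[a b] l] eqn:eq.
    - assert (j : In (u, w) (leaving F (fun x => ~ Z x))).
      { apply in_leaving. repeat split; auto. intros zu. apply HZ in zu. tauto. }
      destruct (leaving F (fun x => ~ Z x)); [destruct j|cbn in nZ; lia].
    - assert (j : In (a, b) (leaving F Z)) by (rewrite eq; now left).
      apply in_leaving in j. destruct j as (j & za & nb). eauto. }
  destruct ex as (x & y & zx & cy & j).
  destruct (walk_path zx) as (l & N & ch & X & la).
  exists l, y.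
  assert (Nuwy : NoDup (u :: w :: l ++ [y])).
  { rewrite Forall_forall in X. change (NoDup ([u] ++ (w :: l) ++ [y])).
    repeat apply NoDup_app; auto; try (repeat constructor; cbn; tauto).
    - intros a ia [<-|[]]. apply X in ia. tauto.
    - intros a [<-|[]] ia. apply in_app_iff in ia. destruct ia as [ia|[->|[]]].
      + apply X in ia. tauto.
      + auto. }
  destruct (@sublist_perm _ (arcs u (w :: l ++ [y])) F) as [F' p].
  - now apply arcs_NoDup.
  - intros [a b] k. destruct k as [k|k]; [congruence|].
    rewrite arcs_app, in_app_iff, la in k.
    destruct k as [k|[k|[]]]; [|congruence].
    revert a b k. now apply chain_arcs.
  - exists F'. auto.
Qed.

(** Peel off one path per listed edge. Each path runs from outside [C] into [C'], so removing it
    preserves conservation in between. The trail recorded for [e] begins after [e] itself. *)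
Lemma flow_decompose (B' : list (V * V)) : forall F,
  unit_flow F -> conserves F -> (forall a b, In (a, b) F -> C a -> C b) -> NoDup B' ->
  (forall u w, In (u, w) B' -> In (u, w) F /\ ~ C u /\ C w /\ ~ C' w) ->
  exists (t : V * V -> list V) (y : V * V -> V),
    (forall e, In e B' ->
       NoDup (snd e :: t e) /\ Forall (fun x => C x /\ ~ C' x) (snd e :: t e) /\ C' (y e) /\
       incl (arcs (snd e) (t e ++ [y e])) F) /\
    (forall e e' a, In e B' -> In e' B' -> e <> e' ->
       In a (arcs (snd e) (t e ++ [y e])) -> ~ In a (arcs (snd e') (t e' ++ [y e']))).
Proof.
  induction B' as [|[u w] B' IH]; intros F U K inw N HB.
  - exists (fun _ => []), snd. split; cbn; tauto.
  - destruct (HB u w) as (i & nu & cw & ncw); [now left|].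
    destruct (flow_peel U K inw i nu cw ncw) as (l & y & F' & Nl & Xl & cy & p).
    inversion N as [|? ? nB' N']; subst.
    assert (inF : forall a, In a F <-> In a (arcs u (w :: l ++ [y])) \/ In a F').
    { intros a. rewrite <- in_app_iff. split; apply Permutation_in; [|symmetry]; assumption. }
    destruct U as (NF & A & O).
    assert (NF' : NoDup (arcs u (w :: l ++ [y]) ++ F')) by (now apply (Permutation_NoDup p)).
    destruct (IH F') as (t & z & H1 & H2).
    + split; [now apply NoDup_app_remove_l in NF'|]. split; intros a b j.
      * apply A, inF; auto.
      * intros k. apply (O a b); apply inF; auto.
    + intros v cv ncv. specialize (K v cv ncv).
      rewrite (net_perm _ p), net_app, net_arcs in K.
      rewrite last_cons, last_app_cons in K. cbn in K. unfold indicator in K.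
      destruct (em (v = u)); [subst; contradiction|].
      destruct (em (v = y)); [subst; contradiction|]. lia.
    + intros a b j. apply (inw a b), inF; auto.
    + assumption.
    (* The peeled path contains no other edge of [B']: after its first arc, its arcs start inside
       [C]. *)
    + intros a b j. destruct (HB a b) as (k & na & cb & ncb); [now right|].
      repeat split; auto. apply inF in k. destruct k as [k|k]; [exfalso|assumption].
      destruct k as [k|k].
      * injection k; intros; subst. contradiction.
      * apply arcs_snoc_fst in k. rewrite Forall_forall in Xl. apply Xl in k. tauto.
    + assert (disj : forall a e, In e B' -> In a (arcs (snd e) (t e ++ [z e])) ->
                  ~ In a (arcs w (l ++ [y]))).
      { intros a e ie ia ja. destruct (H1 e ie) as (_ & _ & _ & inc).
        apply inc in ia. apply in_split in ia. destruct ia as (G1 & G2 & ->).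
        rewrite app_assoc in NF'. apply NoDup_remove_2 in NF'. apply NF'.
        rewrite <- app_assoc, in_app_iff. left. now right. }
      exists (fun e => if em (e = (u, w)) then l else t e),
             (fun e => if em (e = (u, w)) then y else z e).
      split.
      * intros e [<-|ie].
        -- destruct (em ((u, w) = (u, w))); [|congruence]. cbn [snd].
           repeat split; auto. intros a ia. apply inF. left. now right.
        -- destruct (em (e = (u, w))); [subst; contradiction|].
           destruct (H1 e ie) as (h1 & h2 & h3 & h4). repeat split; auto.
           intros a ia. apply inF. auto.
      * intros e e' a ie ie' ne.
        destruct (em (e = (u, w))) as [->|n1], (em (e' = (u, w))) as [->|n2]; cbn [snd].
        -- congruence.
        -- intros ia ja. destruct ie' as [<-|ie']; [congruence|].
           exact (disj a e' ie' ja ia).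
        -- intros ia. destruct ie as [<-|ie]; [congruence|].
           exact (disj a e ie ia).
        -- destruct ie as [<-|ie]; [congruence|]. destruct ie' as [<-|ie']; [congruence|].
           apply H2; auto.
Qed.

(* The trails use disjoint sets of arcs of a flow that never contains both
   orientations of an edge, so they are edge-disjoint. *)
Lemma linkage :
  (forall u w, In (u, w) B -> ~ C' w) ->
  exists (t : V * V -> list V) (y : V * V -> V),
    (forall e, In e B ->
       NoDup (snd e :: t e) /\ Forall (fun x => C x /\ ~ C' x) (snd e :: t e) /\ C' (y e) /\
       chain E (snd e) (t e ++ [y e])) /\
    (forall e e' a b c d, In e B -> In e' B -> e <> e' ->
       In (a, b) (arcs (snd e) (t e ++ [y e])) ->
       In (c, d) (arcs (snd e') (t e' ++ [y e'])) -> ~ same_edge a b c d).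
Proof.
  intros heads. destruct max_flow as (F & U & K & inc & inw).
  destruct (@flow_decompose B F) as (t & y & H1 & H2); auto.
  - apply B_boundary.
  - intros u w i. apply (proj2 B_boundary) in i as i'. destruct i' as (_ & nu & cw).
    repeat split; auto. eauto.
  - exists t, y. destruct U as (_ & A & O). split.
    + intros e i. destruct (H1 e i) as (h1 & h2 & h3 & h4). repeat split; auto.
      apply chain_arcs. intros a b j. apply A, h4, j.
    + intros e e' a b c d ie ie' ne i j [[-> ->]|[-> ->]].
      * exact (H2 e e' (c, d) ie ie' ne i j).
      * apply (O c d); [apply (H1 e' ie')|apply (H1 e ie)]; assumption.
Qed.

End Link.
End Flows.

(** * Rays and regions of minimum boundary *)

Section Graph.
Set Implicit Arguments.
Variable V : Type.
Variable adj : V -> V -> Prop.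
Variable nb : V -> list V.
Hypothesis adj_sym : forall u v, adj u v -> adj v u.
Hypothesis nb_spec : forall u v, adj u v -> In v (nb u).
Hypothesis conn : connected adj.

Notation walk := (walk_in adj).
Notation bd := (boundary_list adj).
Notation ray := (is_ray adj).

Definition tail_in (g : nat -> V) (C : V -> Prop) : Prop :=
  exists N, forall n, N <= n -> C (g n).

Definition connected_set (C : V -> Prop) : Prop :=
  forall x y, C x -> C y -> walk C x y.

Lemma boundary_list_exists (C : V -> Prop) (A : list V) :
  (forall u w, adj u w -> ~ C u -> C w -> In u A) -> exists l, bd C l.
Proof.
  intros H.
  destruct (@exact_list _ (fun a : V * V => adj (fst a) (snd a) /\ ~ C (fst a) /\ C (snd a))
              (flat_map (fun u => map (pair u) (nb u)) A)) as (l & N & Hl).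
  - intros [u w] (e & nu & cw). cbn in *. apply in_flat_map. exists u.
    split; [eauto|]. apply in_map. auto.
  - exists l. split; [assumption|]. intros u w. apply (Hl (u, w)).
Qed.

Lemma component_walk P v x : walk P v x -> walk (walk P v) v x.
Proof.
  intros W. assert (p : P v) by apply (walk_ends W).
  assert (W' := @walk_invariant _ adj P (walk P v) v x W ltac:(now constructor)).
  apply walk_mono with (fun x => P x /\ walk P v x); [|tauto].
  apply W'. intros a b wa _ e pb. now apply walk_snoc with a.
Qed.

Lemma component_connected P v : connected_set (walk P v).
Proof.
  intros x y hx hy. apply walk_app with v.
  - apply walk_sym; [assumption|]. now apply component_walk.
  - now apply component_walk.
Qed.

Lemma component_eq P v w : walk P v w -> walk P v = walk P w.
Proof.
  intros H. apply pred_ext. intros x. split; intros W.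
  - apply walk_app with v; [|assumption]. now apply walk_sym.
  - now apply walk_app with w.
Qed.

(** A walk inside [C'] that left [C] would use a boundary edge of [C] whose inner end lies in
    [C']. *)
Lemma connected_set_sub C C' x :
  connected_set C' -> C' x -> C x ->
  (forall u w, adj u w -> ~ C u -> C w -> ~ C' w) ->
  forall y, C' y -> C y.
Proof.
  intros H c'x cx av y c'y. apply NNPP. intros ny.
  destruct (@walk_exit _ adj C' C x y (H x y c'x c'y) cx ny) as (a & b & W & e & c'b & nb').
  destruct (walk_ends W) as [_ [c'a ca]].
  exact (av b a (adj_sym e) nb' ca c'a).
Qed.

Lemma ray_escapes g (F : list V) : ray g -> tail_in g (fun x => ~ In x F).
Proof.
  intros [inj _]. induction F as [|a F [N HN]]; [exists 0; cbn; tauto|].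
  destruct (em (exists m, g m = a)) as [[m <-]|no].
  - exists (Nat.max N (S m)). intros n le [e|i].
    + apply inj in e. lia.
    + apply (HN n); [lia|assumption].
  - exists N. intros n le [e|i]; [eauto|exact (HN n le i)].
Qed.

(** Eventually the ray avoids the ends of the finitely many boundary edges and can no longer
    cross. *)
Lemma ray_one_side g D l : ray g -> bd D l -> tail_in g D \/ tail_in g (fun x => ~ D x).
Proof.
  intros R [_ Hl].
  destruct (@ray_escapes g (map fst l ++ map snd l) R) as [N HN].
  assert (same : forall n, N <= n -> (D (g n) <-> D (g (S n)))).
  { intros n le. specialize (HN n le). rewrite in_app_iff in HN.
    pose proof (proj2 R n) as e.
    split; intros d; apply NNPP; intros nd; apply HN.
    - right. apply (in_map snd l (g (S n), g n)). apply Hl. auto.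
    - left. apply (in_map fst l (g n, g (S n))). apply Hl. auto. }
  assert (all : forall n, N <= n -> (D (g N) <-> D (g n))).
  { intros n le. induction le; [tauto|]. rewrite IHle. auto. }
  destruct (em (D (g N))) as [d|d]; [left|right]; exists N; intros n le.
  - now apply all.
  - rewrite <- all; assumption.
Qed.

Lemma exhaustion (v : V) :
  exists b : nat -> list V, forall x, exists n, In x (b n).
Proof.
  (* By local finiteness, a finite list [b n] can hold all ends of walks of [n] steps from [v]. *)
  set (b := fix b n := match n with 0 => [v] | S m => flat_map nb (b m) end).
  exists b. intros x. assert (W := walk_sym adj_sym (conn v x)).
  induction W as [u _|u w v _ e _ [n IH]].
  - exists 0. now left.
  - exists (S n). apply in_flat_map. eauto.
Qed.

(** Minimality among subsets of [C] is what bounds the cuts inside [C] in Menger's theorem. *)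
Definition min_region g C l : Prop :=
  connected_set C /\ tail_in g C /\ bd C l /\
  forall Y l', (forall x, Y x -> C x) -> tail_in g Y -> bd Y l' -> length l <= length l'.

Lemma min_region_exists g (F : list V) :
  ray g -> exists C l, min_region g C l /\ forall x, In x F -> ~ C x.
Proof.
  intros R.
  (* The possible boundary sizes of sets that avoid [F] and contain a tail of [g]; connectedness is
     arranged afterwards. *)
  set (Q := fun k => exists Y l, (forall x, In x F -> ~ Y x) /\ tail_in g Y /\ bd Y l /\ length l = k).
  assert (comp_tail : forall Y N, (forall n, N <= n -> Y (g n)) ->
            forall n, N <= n -> walk Y (g N) (g n)).
  { intros Y N HN n le. induction le as [|n le IH].
    - constructor. auto.
    - apply walk_snoc with (g n); auto. apply R. }
  (* A first candidate is the component containing the tail after deleting [F]: the outer ends of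
     its boundary edges lie in [F]. *)
  assert (ex : exists k, Q k).
  { destruct (@ray_escapes g F R) as [N HN].
    destruct (@boundary_list_exists (walk (fun x => ~ In x F) (g N)) F) as [l Hl].
    - intros u w e nu cw. apply NNPP. intros ni. apply nu.
      now apply walk_snoc with w; auto.
    - exists (length l), (walk (fun x => ~ In x F) (g N)), l.
      split; [|split; [|split]]; auto.
      + intros x i W. apply walk_ends in W. tauto.
      + exists N. now apply comp_tail. }
  destruct ex as [k Qk]. destruct (least_nat Q k Qk) as (m & (Y & l & av & [N HN] & Bl & <-) & least).
  assert (sub : forall x, walk Y (g N) x -> Y x) by (intros x W; apply (walk_ends W)).
  (* Passing from [Y] to the component of the tail loses no minimality, as its boundary edges are
     among those of [Y]. *)
  assert (inc : forall u w, adj u w -> ~ walk Y (g N) u -> walk Y (g N) w -> In (u, w) l).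
  { intros u w e nu cw. apply (proj2 Bl). repeat split; auto.
    intros yu. apply nu. now apply walk_snoc with w; auto. }
  destruct (@boundary_list_exists (walk Y (g N)) (map fst l)) as [l' Hl'].
  { intros u w e nu cw. apply (in_map fst l (u, w)). auto. }
  exists (walk Y (g N)), l'. split; [split; [|split; [|split]]|].
  - apply component_connected.
  - exists N. now apply comp_tail.
  - assumption.
  - intros Y' l'' subY t b.
    apply Nat.le_trans with (length l).
    + apply NoDup_incl_length; [apply Hl'|]. intros [u w] i.
      apply (proj2 Hl') in i. now apply inc.
    + apply least. exists Y', l''. split; [|auto].
      intros x i y'x. apply (av x i). auto.
  - intros x i W. apply (av x i). auto.
Qed.

(* Disjoint paths are found greedily, each avoiding all vertices used before. *)
Lemma equiv_of_unseparated r1 r2 :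
  (forall F : list V, exists m n, walk (fun x => ~ In x F) (r1 m) (r2 n)) -> equiv_rays adj r1 r2.
Proof.
  intros H.
  set (good := fun p : V * list V => is_path adj (fst p) (snd p) /\
          (exists m, r1 m = fst p) /\ exists n, r2 n = last (snd p) (fst p)).
  set (verts := fun p : V * list V => fst p :: snd p).
  assert (step : forall F : list V, exists p, good p /\ forall v, In v (verts p) -> ~ In v F).
  { intros F. destruct (H F) as (m & n & W). destruct (walk_path W) as (l & N & c & X & la).
    exists (r1 m, l). rewrite Forall_forall in X.
    split; [split; [split; assumption|cbn; eauto]|exact X]. }
  destruct (step []) as (p0 & g0 & _).
  (* A state holds the newest path and all vertices used so far. *)
  destruct (@dependent_choice ((V * list V) * list V)
      (fun s => good (fst s) /\ incl (verts (fst s)) (snd s))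
      (fun _ s s' => (forall v, In v (verts (fst s')) -> ~ In v (snd s)) /\ incl (snd s) (snd s'))
      (p0, verts p0)) as (f & _ & Hf).
  - split; [assumption|apply incl_refl].
  - intros _ [p F] _. destruct (step F) as (p' & gp & av).
    exists (p', verts p' ++ F). split; split.
    + exact gp.
    + apply incl_appl, incl_refl.
    + exact av.
    + apply incl_appr, incl_refl.
  - assert (mono : forall i j, i <= j -> incl (snd (f i)) (snd (f j))).
    { intros i j le. induction le as [|j le IH]; [apply incl_refl|].
      apply incl_tran with (snd (f j)); [assumption|]. apply Hf. }
    assert (disj : forall i j v, i < j -> In v (verts (fst (f i))) -> ~ In v (verts (fst (f j)))).
    { intros i [|j] v lt iv jv; [lia|].
      destruct (Hf j) as [_ [av _]]. apply (av v jv).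
      apply (mono i j); [lia|]. now apply Hf. }
    exists (fun i => fst (f i)). split.
    + intros i. apply Hf.
    + intros i j ne v iv jv. destruct (Nat.lt_gt_cases i j) as [lg _].
      destruct (lg ne); eapply disj; eauto.
Qed.

(* Consecutive members of a sequence of minimum regions that shrinks to the end
   of [g] are joined by linkages; these concatenate to the required rays. *)
Lemma min_region_linked g C l : ray g -> min_region g C l -> boundary_linked adj C.
Proof.
  intros R M. destruct (exhaustion (g 0)) as (b & b_all).
  (* A state is a minimum region with its boundary. The next one lies inside it, contains no inner
     end of its boundary edges, and avoids [b n], so that the regions shrink to nothing. *)
  destruct (@dependent_choice ((V -> Prop) * list (V * V))
     (fun s => min_region g (fst s) (snd s))
     (fun n s s' => (forall x, fst s' x -> fst s x) /\
        (forall u w, In (u, w) (snd s) -> ~ fst s' w) /\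
        (forall x, In x (b n) -> ~ fst s' x)) (C, l)) as (f & f0 & Hf).
  { exact M. }
  { intros n [D k] Mk. cbn in *. destruct (@min_region_exists g (map snd k ++ b n) R)
      as (D' & k' & M' & av).
    destruct Mk as (_ & [N HN] & Bk & _).
    assert (av' : forall u w, In (u, w) k -> ~ D' w).
    { intros u w i. apply av, in_app_iff. left. apply (in_map snd k (u, w) i). }
    exists (D', k'). cbn. split; [assumption|]. split; [|split; [assumption|]].
    - destruct M' as (cD' & [N' HN'] & _).
      apply (@connected_set_sub D D' (g (Nat.max N N'))); auto.
      + apply HN'. lia.
      + apply HN. lia.
      + intros u w e nu dw. apply (av' u w). apply Bk. auto.
    - intros x i. apply av, in_app_iff. now right. }
  set (D := fun n => fst (f n)). set (B := fun n => snd (f n)).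
  assert (HM : forall n, min_region g (D n) (B n)) by (intros n; apply Hf).
  assert (D_dec : forall n x, D (S n) x -> D n x) by (intros n; apply (Hf n)).
  assert (D0 : D 0 = C) by (unfold D; now rewrite f0).
  assert (B0 : B 0 = l) by (unfold B; now rewrite f0).
  assert (D_mono : forall m n, m <= n -> forall x, D n x -> D m x).
  { intros m n le. induction le; auto. }
  assert (D_vanish : forall F : list V, exists n, forall x, In x F -> ~ D n x).
  { induction F as [|a F [n Hn]]; [exists 0; cbn; tauto|].
    destruct (b_all a) as [k Hk]. exists (Nat.max n (S k)). intros x [<-|i] d.
    - destruct (Hf k) as (_ & _ & _ & av). apply (av a Hk).
      revert d. apply D_mono. lia.
    - apply (Hn x i). revert d. apply D_mono. lia. }
  destruct (@functional_choice nat ((V * V -> list V) * (V * V -> V)) (fun n p =>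
    (forall e, In e (B n) ->
       NoDup (snd e :: fst p e) /\ Forall (fun x => D n x /\ ~ D (S n) x) (snd e :: fst p e) /\
       D (S n) (snd p e) /\ chain adj (snd e) (fst p e ++ [snd p e])) /\
    (forall e e' a b c d, In e (B n) -> In e' (B n) -> e <> e' ->
       In (a, b) (arcs (snd e) (fst p e ++ [snd p e])) ->
       In (c, d) (arcs (snd e') (fst p e' ++ [snd p e'])) -> ~ same_edge a b c d)))
    as [p Hp].
  { intros n. destruct (HM n) as (_ & _ & Bn & least).
    (* Any set between [D (S n)] and [D n] contains a tail of [g], so minimality of [D n] supplies
       the cut condition. *)
    destruct (@linkage _ adj adj_sym (D n) (D (S n)) (B n)) as (t & y & H1 & H2); auto.
    - intros Y l' s1 s2 bY. apply (least Y l'); auto.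
      destruct (HM (S n)) as (_ & [N HN] & _). exists N. auto.
    - intros u w i. destruct (Hf n) as (_ & _ & hd & _). exact (hd u w i).
    - exists (t, y). auto. }
  set (t := fun n => fst (p n)). set (y := fun n => snd (p n)).
  (* [es e n] is the boundary edge through which the ray begun at [e] enters [D n]: the last arc of
     its trail at one level is the entering edge of the next. *)
  set (es := fun e => fix es n := match n with
               | 0 => e | S m => (last (t m (es m)) (snd (es m)), y m (es m)) end).
  assert (es_in : forall e n, In e l -> In (es e n) (B n)).
  { intros e n i. induction n as [|n IH]; [cbn; now rewrite B0|].
    destruct (Hp n) as [Hn _]. destruct (Hn _ IH) as (_ & F & dy & c).
    apply chain_app in c. cbn [es]. destruct (HM (S n)) as (_ & _ & Bn & _).
    apply Bn. split; [apply c|]. split; [|exact dy].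
    rewrite Forall_forall in F. apply F, last_In. }
  assert (exit_arc : forall n e, In (last (t n e) (snd e), y n e) (arcs (snd e) (t n e ++ [y n e]))).
  { intros n e. rewrite arcs_app. apply in_app_iff. right. now left. }
  assert (es_inj : forall e e', In e l -> In e' l -> e <> e' -> forall n, es e n <> es e' n).
  { intros e e' i i' ne n. induction n as [|n IH]; [exact ne|].
    cbn [es]. intros eq. destruct (Hp n) as [_ Hn].
    apply (Hn (es e n) (es e' n) _ _ _ _ (es_in e n i) (es_in e' n i') IH
             (exit_arc n (es e n)) (exit_arc n (es e' n))).
    left. split; congruence. }
  assert (rays : forall e, exists r, In e l ->
     ray_in_boundary_graph adj C r /\ r 0 = fst e /\ r 1 = snd e /\
     (forall n, tail_in r (D n)) /\
     forall m, m = 0 \/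
       exists n, In (r m, r (S m)) (arcs (snd (es e n)) (t n (es e n) ++ [y n (es e n)]))).
  { intros e. destruct (em (In e l)) as [i|ni]; [|exists g; tauto].
    destruct (@concat_segments V adj D (fun n => snd (es e n)) (fun n => t n (es e n)))
      as (r & [inj st] & r0 & tl & ar).
    - assumption.
    - intros n. destruct (Hp n) as [Hn _]. destruct (Hn _ (es_in e n i)) as (h1 & h2 & _ & h4).
      cbn [es snd]. auto.
    - assert (i' : In (fst e, snd e) (B 0)) by (rewrite B0; now destruct e).
      destruct (HM 0) as (_ & _ & B0' & _). apply B0' in i'. rewrite D0 in i'.
      destruct i' as (ae & nu & cw).
      assert (r_in : forall m, C (r m)).
      { intros m. destruct (ar m) as [n a]. cbn [es snd] in a. apply arcs_snoc_fst in a.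
        destruct (Hp n) as [Hn _]. destruct (Hn _ (es_in e n i)) as (_ & F & _).
        rewrite Forall_forall in F. apply F in a. rewrite <- D0.
        apply (D_mono 0 n); [lia|tauto]. }
      (* Prepend the outer end of [e]; it lies outside [C] and [r] inside, so the sequence stays
         injective. *)
      exists (fun m => match m with 0 => fst e | S m => r m end). intros _.
      split; [|split; [|split; [|split]]].
      + split; [split|].
        * intros [|m] [|n] eq; auto.
          -- exfalso. apply nu. rewrite eq. auto.
          -- exfalso. apply nu. rewrite <- eq. auto.
        * intros [|m]; [now rewrite r0|auto].
        * intros [|m]; auto.
      + reflexivity.
      + exact r0.
      + intros n. destruct (tl n) as [N HN]. exists (S N).
        intros [|m] le; [lia|]. apply HN. lia.
      + intros [|m]; [now left|]. right. apply ar. }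
  apply functional_choice in rays. destruct rays as [R' HR].
  (* Without boundary edges the empty family suffices; otherwise [e0] serves as the default for
     [nth]. *)
  destruct l as [|e0 l0] eqn:el.
  { exists (fun _ => False), (fun _ => g). split; [tauto|]. split; [tauto|]. split; [tauto|].
    intros u w [e s]. exfalso.
    destruct M as (_ & _ & [_ b'] & _).
    destruct s as [[cu nw]|[nu cw]].
    - apply (b' w u). auto.
    - apply (b' u w). auto. }
  rewrite <- el in *. clear el l0.
  assert (nth_l : forall i, i < length l -> In (nth i l e0) l) by (intros; now apply nth_In).
  exists (fun i => i < length l), (fun i => R' (nth i l e0)).
  split; [|split; [|split]].
  - intros i li. apply HR; auto.
  - intros i j li lj ne m n.
    assert (ne' : nth i l e0 <> nth j l e0).
    { intros eq. apply ne. destruct M as (_ & _ & [ND _] & _).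
      apply (proj1 (NoDup_nth l e0) ND); auto. }
    pose proof (nth_l i li) as ii. pose proof (nth_l j lj) as jj.
    revert ne' ii jj. generalize (nth i l e0) (nth j l e0). clear i j li lj ne.
    intros e e' ne i j.
    (* An arc of level [n] starts in [D n] outside [D (S n)] and ends in [D n], so edges of
       different levels differ. *)
    assert (layer : forall e n a c, In e l ->
       In (a, c) (arcs (snd (es e n)) (t n (es e n) ++ [y n (es e n)])) ->
       D n a /\ ~ D (S n) a /\ D n c).
    { clear - Hp es_in D_dec. intros e n a c i k.
      destruct (Hp n) as [Hn _]. destruct (Hn _ (es_in e n i)) as (_ & F & dy & _).
      rewrite Forall_forall in F. pose proof (arcs_snoc_fst _ _ _ _ _ k) as ka.
      apply F in ka. apply arcs_in in k. destruct k as [_ k].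
      apply in_app_iff in k. repeat split; try tauto.
      destruct k as [k|[<-|[]]]; [apply F; now right|auto]. }
    assert (first : forall e, In e l -> ~ D 0 (R' e 0)).
    { intros e1 i1. destruct (HR e1 i1) as (_ & -> & _).
      destruct M as (_ & _ & [_ b'] & _). rewrite D0.
      destruct e1 as [u w]. apply b' in i1. tauto. }
    destruct (HR e i) as (_ & e_0 & e_1 & _ & ar).
    destruct (HR e' j) as (_ & e'_0 & e'_1 & _ & ar').
    destruct (ar m) as [->|[k a]], (ar' n) as [->|[k' a']].
    + rewrite e_0, e_1, e'_0, e'_1.
      pose proof (es_inj e e' i j ne 0) as nn.
      destruct M as (_ & _ & [_ b'] & _).
      destruct e as [u w], e' as [u' w']. cbn.
      apply b' in i, j. intros [[-> ->]|[-> ->]]; tauto.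
    + apply (layer e' k' _ _ j) in a'. pose proof (first e i) as nf.
      destruct a' as (x1 & _ & x2).
      apply (D_mono 0 k' ltac:(lia)) in x1, x2.
      intros [[q1 q2]|[q1 q2]]; rewrite q1 in nf; contradiction.
    + apply (layer e k _ _ i) in a. pose proof (first e' j) as nf.
      destruct a as (x1 & _ & x2).
      apply (D_mono 0 k ltac:(lia)) in x1, x2.
      intros [[q1 q2]|[q1 q2]].
      * rewrite <- q1 in nf; contradiction.
      * rewrite <- q2 in nf; contradiction.
    + destruct (Nat.lt_total k k') as [lt|[<-|lt]].
      * apply (layer e k _ _ i) in a. apply (layer e' k' _ _ j) in a'.
        destruct a as (_ & nx & _), a' as (x1 & _ & x2).
        apply (D_mono (S k) k' lt) in x1, x2.
        intros [[q1 q2]|[q1 q2]]; rewrite q1 in nx; contradiction.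
      * destruct (Hp k) as [_ Hk].
        apply (Hk _ _ _ _ _ _ (es_in e k i) (es_in e' k j) (es_inj e e' i j ne k) a a').
      * apply (layer e k _ _ i) in a. apply (layer e' k' _ _ j) in a'.
        destruct a' as (_ & nx & _), a as (x1 & _ & x2).
        apply (D_mono (S k') k lt) in x1, x2.
        intros [[q1 q2]|[q1 q2]].
        -- rewrite <- q1 in nx; contradiction.
        -- rewrite <- q2 in nx; contradiction.
  (* Some [D n] misses [F]; it is connected and contains tails of both rays. *)
  - intros i j li lj. apply equiv_of_unseparated. intros F.
    destruct (D_vanish F) as [n Hn].
    destruct (HR _ (nth_l i li)) as (_ & _ & _ & ti & _).
    destruct (HR _ (nth_l j lj)) as (_ & _ & _ & tj & _).
    destruct (ti n) as [N1 H1], (tj n) as [N2 H2]. exists N1, N2.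
    apply walk_mono with (D n); [|intros x d ix; exact (Hn x ix d)].
    apply (HM n); auto.
  - assert (key : forall u w, In (u, w) l -> exists i, i < length l /\
        R' (nth i l e0) 0 = u /\ R' (nth i l e0) 1 = w).
    { intros u w i. destruct (In_nth _ _ e0 i) as (k & lk & ek).
      exists k. split; [assumption|]. rewrite ek.
      destruct (HR _ i) as (_ & h0 & h1 & _). auto. }
    intros u w [e s]. destruct M as (_ & _ & [_ b'] & _). destruct s as [[cu nw]|[nu cw]].
    + destruct (key w u) as (i & li & h0 & h1); [apply b'; auto|].
      exists i. split; [assumption|]. right. auto.
    + destruct (key u w) as (i & li & h0 & h1); [apply b'; auto|].
      exists i. split; [assumption|]. left. auto.
Qed.

(** * Splitting off one end at a time *)

(** The quantifier over all [A] lets the solution for a component be asked to contain the set that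
    cut it out. *)
Definition resolvable (D : V -> Prop) : Prop :=
  forall A : list V, exists A2, incl A A2 /\
    forall v, D v -> ~ In v A2 ->
      boundary_linked adj (walk (fun x => D x /\ ~ In x A2) v).

Definition stuck D := ~ resolvable D /\ connected_set D /\ exists l, bd D l.

Lemma stuck_nonempty D : stuck D -> exists x, D x.
Proof.
  intros [nr _]. apply NNPP. intros no. apply nr. intros A. exists A.
  split; [apply incl_refl|]. intros v d. exfalso. eauto.
Qed.

(** An empty [C] covers the cases where [g] is not a ray or has a tail outside [D]. Otherwise [C] is
    a minimum region, kept inside [D] because it avoids the inner ends of the boundary edges of
    [D]. *)
Lemma region_for_ray g D lD (A : list V) :
  connected_set D -> bd D lD -> incl (map snd lD) A ->
  exists C lC, bd C lC /\ connected_set C /\ (forall x, C x -> D x) /\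
    (forall x, C x -> ~ In x A) /\ (forall x, C x -> boundary_linked adj C) /\
    (ray g -> tail_in g (fun x => C x \/ ~ D x)).
Proof.
  intros cD bD inc.
  assert (empty : (ray g -> tail_in g (fun x => ~ D x)) ->
    exists C lC, bd C lC /\ connected_set C /\ (forall x, C x -> D x) /\
      (forall x, C x -> ~ In x A) /\ (forall x, C x -> boundary_linked adj C) /\
      (ray g -> tail_in g (fun x => C x \/ ~ D x))).
  { intros H. exists (fun _ => False), []. split; [split; [constructor|cbn; tauto]|].
    split; [intros x y []|]. repeat (split; [tauto|]).
    intros R. destruct (H R) as [N HN]. exists N. auto. }
  destruct (em (ray g)) as [R|nR]; [|apply empty; tauto].
  destruct (ray_one_side R bD) as [[N HN]|t]; [|apply empty; auto].
  destruct (min_region_exists A R) as (C & lC & M & av).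
  pose proof (min_region_linked R M) as link.
  destruct M as (cC & [N' HN'] & bC & _).
  exists C, lC. split; [assumption|]. split; [assumption|]. split.
  - apply (@connected_set_sub D C (g (Nat.max N N'))); auto.
    + apply HN'. lia.
    + apply HN. lia.
    + intros u w e nu dw cw. apply (av w); [|assumption].
      apply inc, (in_map snd lD (u, w)). apply bD. auto.
  - split; [intros x cx i; exact (av x i cx)|]. split; [auto|].
    intros _. exists N'. auto.
Qed.

(* Split off a region around the end of [g]. If all components of the rest were
   resolvable, their solutions together would resolve [D]. *)
Lemma stuck_step D x0 (g : nat -> V) :
  stuck D ->
  exists D', stuck D' /\ (forall x, D' x -> D x) /\ ~ D' x0 /\
    (ray g -> tail_in g (fun x => ~ D' x)).
Proof.
  intros (nr & cD & lD & bD).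
  apply not_all_ex_not in nr. destruct nr as [A nA].
  (* Deleting [x0] makes the new region miss it; deleting the inner ends of the boundary edges of
     [D] cuts off the outside. *)
  set (A1 := A ++ x0 :: map snd lD).
  destruct (@region_for_ray g D lD A1 cD bD) as (C & lC & bC & cC & CD & CA & Clink & Ctail).
  { intros x i. apply in_app_iff. right. now right. }
  (* Deleting the outer ends of the boundary edges of [C] as well cuts [C] off from the rest [Q]. *)
  set (A3 := A1 ++ map fst lC).
  set (Q := fun x => D x /\ ~ C x /\ ~ In x A3).
  assert (C_out : forall u w, adj u w -> C w -> ~ C u -> In u A3).
  { intros u w e cw nu. apply in_app_iff. right. apply (in_map fst lC (u, w)). apply bC. auto. }
  assert (D_out : forall u w, adj u w -> D w -> ~ D u -> In w A3).
  { intros u w e dw nu. apply in_app_iff. left. apply in_app_iff. right. right.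
    apply (in_map snd lD (u, w)). apply bD. auto. }
  assert (K_out : forall v u w, adj u w -> ~ walk Q v u -> walk Q v w -> In u A3).
  { intros v u w e nu kw. apply NNPP. intros ni. apply nu.
    apply walk_snoc with w; auto. destruct (walk_ends kw) as [_ (dw & nw & nA3)].
    split; [|split; [|assumption]].
    - apply NNPP. intros nd. apply nA3. now apply D_out with u.
    - intros cu. apply nA3. now apply C_out with u; auto. }
  assert (x0A : In x0 A3).
  { apply in_app_iff. left. apply in_app_iff. right. now left. }
  destruct (em (exists v, Q v /\ ~ resolvable (walk Q v))) as [(v & qv & bad)|all].
  - exists (walk Q v). split; [split; [assumption|split]|split; [|split]].
    + apply component_connected.
    + apply boundary_list_exists with A3. apply K_out.
    + intros x W. apply (walk_ends W).
    + intros W. destruct (walk_ends W) as [_ (_ & _ & n)]. contradiction.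
    + intros R. destruct (Ctail R) as [N HN]. exists N. intros n le W.
      destruct (walk_ends W) as [_ (d & nc & _)]. destruct (HN n le); contradiction.
  - exfalso. apply nA.
    (* [G K] solves a resolvable [K] and contains [A3]; for other [K] it is a dummy. *)
    destruct (@functional_choice (V -> Prop) (list V) (fun K A2 => resolvable K ->
      incl A3 A2 /\ forall v, K v -> ~ In v A2 ->
        boundary_linked adj (walk (fun x => K x /\ ~ In x A2) v))) as [G HG].
    { intros K. destruct (em (resolvable K)) as [r|n]; [|exists []; tauto].
      destruct (r A3) as (A2 & H). exists A2. auto. }
    assert (HQ : forall v, Q v -> resolvable (walk Q v)).
    { intros v qv. apply NNPP. intros n. apply all. eauto. }
    set (L := flat_map nb A3).
    (* A walk from [v] to [x0], which lies in [A3], first leaves the component of [v] at a vertex of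
       [A3]. So every component has a representative in the finite list [L]. *)
    assert (reps : forall v, Q v -> exists w, In w L /\ walk Q v w).
    { intros v qv. destruct (@walk_exit _ adj _ (walk Q v) v x0 (conn v x0)) as (a & b & W & e & _ & nb').
      - now constructor.
      - intros W. destruct (walk_ends W) as [_ (_ & _ & n)]. contradiction.
      - exists a. destruct (walk_ends W) as [_ [_ ka]]. split; [|assumption].
        apply in_flat_map. exists b. split; [|auto]. now apply (K_out v b a); auto. }
    (* Each solution set is restricted to its own component, so that it disturbs neither [C] nor the
       other components. *)
    destruct (@exact_list V (fun y => In y A3 \/ exists w, In w L /\ walk Q w y /\ In y (G (walk Q w)))
                (A3 ++ flat_map (fun w => G (walk Q w)) L)) as (A2 & _ & HA2).
    { intros y i. apply in_app_iff. destruct i as [i|(w & iw & _ & i)]; [auto|].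
      right. apply in_flat_map. eauto. }
    exists A2. split.
    + intros x i. apply HA2. left. apply in_app_iff. left. apply in_app_iff. auto.
    + intros v dv ni.
      assert (nA3 : forall x, ~ In x A2 -> ~ In x A3).
      { intros x n i. apply n, HA2. auto. }
      destruct (em (C v)) as [cv|ncv].
      (* [C] survives as a component: it is connected, misses [A2], and its outer neighbours lie in
         [A3]. *)
      * replace (walk (fun x => D x /\ ~ In x A2) v) with C; [eauto|].
        apply pred_ext. intros x. split.
        -- intros cx. apply walk_mono with C; [auto|]. intros z cz. split; [auto|].
           rewrite HA2. intros [i|(w & _ & W & _)].
           ++ apply in_app_iff in i. destruct i as [i|i]; [exact (CA z cz i)|].
              apply in_map_iff in i. destruct i as ([a b] & <- & i).
              apply bC in i. tauto.
           ++ destruct (walk_ends W) as [_ (_ & n & _)]. contradiction.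
        -- intros W. apply (@walk_invariant _ adj _ C) in W; [apply (walk_ends W)|assumption|].
           intros a b ca _ e [_ nb']. apply NNPP. intros ncb.
           apply (nA3 b nb'). now apply C_out with a; auto.
      * assert (qv : Q v) by (split; auto).
        destruct (HG _ (HQ v qv)) as [incG HGv].
        assert (K_spec : forall x, walk Q v x -> (In x A2 <-> In x (G (walk Q v)))).
        { intros x W. rewrite HA2. split.
          - intros [i|(w & _ & W' & i)]; [auto|].
            rewrite (component_eq W), <- (component_eq W'). exact i.
          - intros i. right. destruct (reps v qv) as (w & iw & Ww). exists w.
            split; [assumption|]. rewrite <- (component_eq Ww). auto. }
        (* Inside the component of [v], [A2] agrees with that component's own solution, and the
           component can only be left through [A3]. *)
        replace (walk (fun x => D x /\ ~ In x A2) v)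
          with (walk (fun x => walk Q v x /\ ~ In x (G (walk Q v))) v).
        -- apply HGv; [now constructor|]. rewrite <- K_spec; [assumption|now constructor].
        -- apply pred_ext. intros x. split; intros W.
           ++ apply walk_mono with (1 := W). intros z [kz nz]. split.
              ** apply (walk_ends kz).
              ** now rewrite (K_spec z kz).
           ++ apply (@walk_invariant _ adj _ (walk Q v)) in W.
              ** apply walk_mono with (1 := W). intros z [[dz nz] kz]. split; [assumption|].
                 now rewrite <- (K_spec z kz).
              ** now constructor.
              ** intros a b ka _ e [db nb']. apply walk_snoc with a; auto.
                 split; [assumption|]. split; [|auto].
                 intros cb. destruct (walk_ends ka) as [_ (_ & nca & na)].
                 apply na. now apply C_out with b.
Qed.

(** One of the disjoint paths avoids the initial segments of both rays and the outer ends of the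
    boundary edges of [D]; it would lead from [D] to its complement without crossing the
    boundary. *)
Lemma equiv_rays_same_side r1 r2 D l :
  equiv_rays adj r1 r2 -> bd D l ->
  tail_in r1 D -> tail_in r2 (fun x => ~ D x) -> False.
Proof.
  intros (P & HP & disj) bD [N1 H1] [N2 H2].
  set (verts := fun i => fst (P i) :: snd (P i)).
  assert (avoid : forall F : list V, exists N, forall i, N <= i -> forall x, In x F -> ~ In x (verts i)).
  { induction F as [|a F [N HN]]; [exists 0; cbn; tauto|].
    destruct (em (exists i, In a (verts i))) as [[i ia]|no].
    - exists (Nat.max N (S i)). intros j le x [<-|ix].
      + apply (disj i j); [lia|exact ia].
      + apply HN; [lia|assumption].
    - exists N. intros j le x [<-|ix]; [eauto|]. now apply HN. }
  destruct (avoid (map fst l ++ map r1 (seq 0 N1) ++ map r2 (seq 0 N2))) as [i Hi].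
  specialize (Hi i (le_n _)).
  destruct (HP i) as ([_ ch] & [m em1] & [n en]).
  assert (start : D (fst (P i))).
  { rewrite <- em1. destruct (le_lt_dec N1 m); [auto|exfalso].
    apply (Hi (r1 m)).
    - rewrite !in_app_iff. right. left. apply in_map, in_seq. lia.
    - rewrite em1. now left. }
  assert (stop : ~ D (last (snd (P i)) (fst (P i)))).
  { rewrite <- en. destruct (le_lt_dec N2 n); [auto|exfalso].
    apply (Hi (r2 n)).
    - rewrite !in_app_iff. right. right. apply in_map, in_seq. lia.
    - rewrite en. apply last_In. }
  assert (W : walk (fun x => In x (verts i)) (fst (P i)) (last (snd (P i)) (fst (P i)))).
  { apply path_walk; [assumption|]. apply Forall_forall. auto. }
  destruct (@walk_exit _ adj _ D _ _ W start stop) as (a & b & W' & e & ib & nd).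
  destruct (walk_ends W') as [_ [_ da]].
  apply (Hi b); [|exact ib].
  apply in_app_iff. left. apply (in_map fst l (b, a)). apply bD. auto.
Qed.

Lemma all_resolvable : countably_many_ends adj -> resolvable (fun _ => True).
Proof.
  intros [f Hf]. apply NNPP. intros nr.
  assert (s0 : stuck (fun _ => True)).
  { split; [assumption|]. split; [intros x y _ _; apply conn|].
    exists []. split; [constructor|]. cbn. tauto. }
  destruct (stuck_nonempty s0) as [x0 _].
  (* A state is a stuck region with a vertex in it. Step [n] expels the end of [f n]; the path from
     the old vertex to the new one stays outside the next region until its final vertex. *)
  destruct (@dependent_choice ((V -> Prop) * V)
    (fun s => stuck (fst s) /\ fst s (snd s))
    (fun n s s' => (forall x, fst s' x -> fst s x) /\
       (ray (f n) -> tail_in (f n) (fun x => ~ fst s' x)) /\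
       exists t, NoDup (snd s :: t) /\ Forall (fun x => fst s x /\ ~ fst s' x) (snd s :: t) /\
         chain adj (snd s) (t ++ [snd s']))
    ((fun _ => True), x0)) as (d & _ & Hd).
  - split; [exact s0|exact I].
  - intros n [D x] [sD dx]. cbn in *.
    destruct (@stuck_step D x (f n) sD) as (D' & sD' & sub & nx & tl).
    destruct (stuck_nonempty sD') as [y d'y].
    assert (W : walk D x y).
    { destruct sD as (_ & cD & _). auto. }
    (* Stop at the first vertex [b] of [D']; the start [x] is outside [D'] by the choice of [D']. *)
    destruct (@walk_exit _ adj D (fun z => ~ D' z) x y W) as (a & b & W' & e & db & nb'); [assumption|tauto|].
    destruct (walk_path W') as (t & N & ch & F & la).
    exists (D', b). cbn. apply NNPP in nb'. split; [auto|]. split; [assumption|].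
    split; [assumption|]. exists t. split; [assumption|]. split; [assumption|].
    apply chain_app. rewrite la. cbn. auto.
  - destruct (@functional_choice nat (list V) (fun n t =>
       NoDup (snd (d n) :: t) /\
       Forall (fun x => fst (d n) x /\ ~ fst (d (S n)) x) (snd (d n) :: t) /\
       chain adj (snd (d n)) (t ++ [snd (d (S n))]))) as [t Ht].
    { intros n. apply (Hd n). }
    destruct (@concat_segments V adj (fun n => fst (d n)) (fun n => snd (d n)) t)
      as (r & R & _ & tl & _).
    + intros n. apply (Hd n).
    + exact Ht.
    (* The listed ray [f n] equivalent to [r] has a tail outside the region of [d (S n)], while [r]
       has a tail inside it. *)
    + destruct (Hf r R) as (n & Rn & eq).
      destruct (Hd (S n)) as [[(_ & _ & l & bl) _] _].
      destruct (Hd n) as [_ (_ & out & _)].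
      exact (equiv_rays_same_side eq bl (tl (S n)) (out Rn)).
Qed.

End Graph.

Theorem theorem2p2 (V : Type) (adj : V -> V -> Prop) :
  simple_graph adj -> locally_finite adj -> connected adj ->
  countably_many_ends adj ->
  forall A' : V -> Prop, finite_set A' ->
  exists A : V -> Prop, finite_set A /\ (forall x, A' x -> A x) /\
    forall C : V -> Prop, component_of_minus adj A C ->
      boundary_linked adj C.
Proof.
  intros [sym _] lf conn ends A' [l Hl].
  apply functional_choice in lf. destruct lf as [nb Hnb].
  destruct (all_resolvable nb sym Hnb conn ends l) as (A2 & inc & H).
  exists (fun x => In x A2). split; [exists A2; auto|]. split; [auto|].
  intros C (v & nv & HC).
  replace C with (walk_in adj (fun x => True /\ ~ In x A2) v); [auto|].
  apply pred_ext. intros x. rewrite HC.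
  split; intros W; apply walk_mono with (1 := W); tauto.
Qed.
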